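(* Let $G$ be a graph with $m$ edges and let $k\ge 0$ be an integer. Then $$\alpha_{k-reg}(L(G))\ge \frac{m^{1/3}}{4\chi_k(L(G))}.$$
   Context: All graphs are finite, simple and undirected. $L(G)$ is the line graph of $G$. For a graph $H$, $D_i(H)$ denotes the set of vertices of degree $i$ in $H$. For an integer $k\ge 0$, a set $S\subseteq V(H)$ is $k$-independent if $H[S]$ has maximum degree at most $k$; a regular $k$-independent set is a $k$-independent set contained in some $D_i(H)$; $\alpha_{k-reg}(H)$ is the maximum cardinality of a regular $k$-independent set of $H$. The $k$-chromatic number $\chi_k(H)$ is the minimum number of colors in a coloring of $V(H)$ such that each color class induces a subgraph of maximum degree at most $k$. *)

(* Defs.v *)
From HB Require Import structures.
From mathcomp Require Import all_boot.

Set Implicit Arguments.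
Unset Strict Implicit.
Unset Printing Implicit Defensive.

Record sgraph := SGraph {
  vertex :> finType;
  adj : rel vertex;
  adj_sym : symmetric adj;
  adj_irr : irreflexive adj }.

Definition edges (G : sgraph) : {set {set G}} :=
  [set e : {set G} | [exists x : G, exists y : G, adj x y && (e == [set x; y])]].

Definition line_vertex (G : sgraph) := {e : {set G} | e \in edges G}.

Definition line_adj (G : sgraph) : rel (line_vertex G) :=
  fun e f => (e != f) && (val e :&: val f != set0).

Lemma line_adj_sym (G : sgraph) : symmetric (@line_adj G).
Proof. by move=> e f; rewrite /line_adj eq_sym setIC. Qed.

Lemma line_adj_irr (G : sgraph) : irreflexive (@line_adj G).
Proof. by move=> e; rewrite /line_adj eqxx. Qed.

Definition line_graph (G : sgraph) : sgraph :=
  SGraph (@line_adj_sym G) (@line_adj_irr G).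

Section Induced.
Variables (H : sgraph) (S : {set H}).

Definition induced_vertex := {x : H | x \in S}.

Definition induced_adj : rel induced_vertex := fun x y => adj (val x) (val y).

Lemma induced_adj_sym : symmetric induced_adj.
Proof. by move=> x y; apply: adj_sym. Qed.

Lemma induced_adj_irr : irreflexive induced_adj.
Proof. by move=> x; apply: adj_irr. Qed.

Definition induced : sgraph := SGraph induced_adj_sym induced_adj_irr.

End Induced.

Definition degree (H : sgraph) (v : H) : nat := #|[set w : H | adj v w]|.

Definition max_degree (H : sgraph) : nat := \max_(v : H) degree v.

Definition degree_class (H : sgraph) (i : nat) : {set H} :=
  [set v : H | degree v == i].

Definition k_independent (H : sgraph) (k : nat) (S : {set H}) : bool :=
  max_degree (induced S) <= k.

(* Every degree is at most #|H|, so bounding i loses no degree class and keeps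
   the predicate boolean. *)
Definition regular_k_independent (H : sgraph) (k : nat) (S : {set H}) : bool :=
  k_independent k S && [exists i : 'I_#|H|.+1, S \subset degree_class H i].

Definition alpha_reg (k : nat) (H : sgraph) : nat :=
  \max_(S : {set H} | regular_k_independent k S) #|S|.

Definition k_colorable (k : nat) (H : sgraph) (n : nat) : bool :=
  [exists f : {ffun H -> 'I_n},
     forall c : 'I_n, k_independent k [set v : H | f v == c]].

Lemma k_colorable_exists (k : nat) (H : sgraph) : exists n, k_colorable k H n.
Proof.
exists #|H|; apply/existsP; exists [ffun v : H => enum_rank v].
apply/forallP => c; rewrite /k_independent; apply/bigmax_leqP => v _.
rewrite /degree eq_card0 // => w; rewrite !inE /= /induced_adj.
have /[!inE] := valP v; have /[!inE] := valP w; rewrite !ffunE.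
move=> /eqP ew /eqP ev; have -> : val v = val w.
  by apply: enum_rank_inj; rewrite ev ew.
exact: adj_irr.
Qed.

Definition chi (k : nat) (H : sgraph) : nat := ex_minn (k_colorable_exists k H).

(* Main.v *)
Require Import Defs.
From mathcomp Require Import all_boot all_order all_algebra.
From mathcomp Require Import reals exp.
From mathcomp Require Import zify.

Set Implicit Arguments.
Unset Strict Implicit.
Unset Printing Implicit Defensive.

Import Order.TTheory GRing.Theory Num.Theory.

(** Let [r] bound the size of every degree class of [L(G)] and let [D] be the
    maximum degree of [G].  Degrees in [L(G)] are less than [2 D], so
    [m <= 2 D r].  At a vertex [v] of degree [D], an edge [e] through [v] has
    degree [D - 1 + g e], where [g e] counts the edges that meet [e] but avoid
    [v].  An edge avoiding [v] meets at most two edges through [v], so the sum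
    of [g] over the edges through [v] is at most [2 m]; since [g] takes each
    value at most [r] times there, [(D - r t) t <= 2 m] for every [t].
    With [t = 16 r] the two inequalities give [m <= 64 r ^ 3].  Finally
    [r = chi * alpha] is such a bound, because an optimal colouring splits a
    degree class into [chi] regular [k]-independent sets. *)

Section PigeonHole.

Variables (T : finType) (A : {set T}) (g : T -> nat) (r : nat).
Hypothesis g_fiber : forall j, #|[set x in A | g x == j]| <= r.

Lemma card_lt_fiber t : #|[set x in A | g x < t]| <= r * t.
Proof.
elim: t => [|t IH];
  first by rewrite muln0 leqn0 cards_eq0; apply/eqP/setP=> x; rewrite !inE andbF.
have -> : [set x in A | g x < t.+1] = [set x in A | g x < t] :|: [set x in A | g x == t].
  by apply/setP=> x; rewrite !inE -andb_orr ltnS leq_eqVlt orbC.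
by rewrite mulnS addnC (leq_trans (leq_card_setU _ _)) // leq_add.
Qed.

(** Fewer than [t] is attained at most [r * t] times, so at least [#|A| - r * t] elements contribute
    [t] or more each; truncated subtraction makes the bound trivial for large [t]. *)
Lemma sum_ge_fiber t : (#|A| - r * t) * t <= \sum_(x in A) g x.
Proof.
have cA : #|A| - r * t <= #|[set x in A | t <= g x]|.
  rewrite leq_subLR; apply: leq_trans (leq_add (card_lt_fiber t) (leqnn _)).
  apply: leq_trans (leq_card_setU _ _); apply/subset_leq_card/subsetP=> x xA.
  by rewrite !inE xA /= ltnNge orNb.
apply: leq_trans (_ : \sum_(x in [set x in A | t <= g x]) t <= _).
  by rewrite sum_nat_const leq_mul2r cA orbT.
apply: leq_trans (_ : \sum_(x in [set x in A | t <= g x]) g x <= _).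
  by apply: leq_sum => x; rewrite inE => /andP[].
rewrite [leqLHS]big_mkcond [leqRHS]big_mkcond; apply: leq_sum => x _.
by rewrite inE; case: (x \in A) => //=; case: ifP.
Qed.

End PigeonHole.

Section LineGraphDegrees.

Variable G : sgraph.
Implicit Types (e f : line_vertex G) (v x : G).

Definition star v : {set line_vertex G} := [set e : line_vertex G | v \in val e].

Lemma edge_card e : #|val e| = 2.
Proof.
have := valP e; rewrite inE => /existsP[x /existsP[y /andP[xy /eqP ->]]].
rewrite cards2; case: eqP xy => // ->; by rewrite adj_irr.
Qed.

Lemma edge_pair e v x : v \in val e -> x \in val e -> v != x -> val e = [set v; x].
Proof.
move=> ve xe vx; apply/esym/eqP; rewrite eqEcard edge_card cards2 vx leqnn andbT.
by apply/subsetP=> y; rewrite !inE => /orP[] /eqP->.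
Qed.

Lemma card_line_vertex : #|{: line_vertex G}| = #|edges G|.
Proof. by rewrite card_sig; apply: eq_card => e. Qed.

Lemma line_degree_lt (D : nat) (e : line_graph G) :
  (forall v, #|star v| <= D) -> degree e < D.*2.
Proof.
move=> starD.
have: [set f | adj e f] \subset \bigcup_(x in val e) (star x :\ e).
  apply/subsetP=> f; rewrite inE => /andP[nef /set0Pn[x]].
  rewrite inE => /andP[xe xf]; apply/bigcupP; exists x => //.
  by rewrite !inE eq_sym nef.
move/subset_leq_card; rewrite -/(degree e) => /leq_trans le_deg.
have /le_deg le_deg' : #|\bigcup_(x in val e) (star x :\ e)|
    <= \sum_(x in val e) #|star x :\ e|.
  elim/big_ind2: _ => [|a A b B cA cB|x _] //; first by rewrite cards0.
  by rewrite (leq_trans (leq_card_setU _ _)) // leq_add.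
have starE x : x \in val e -> #|star x :\ e| <= D.-1.
  by move=> xe; have := starD x; rewrite (cardsD1 e) inE xe; case: (D).
have le_sum : \sum_(x in val e) #|star x :\ e| <= 2 * D.-1.
  by rewrite -(edge_card e) -sum_nat_const; apply: leq_sum.
have /card_gt0P[x xe] : 0 < #|val e| by rewrite edge_card.
(* Strictness needs [0 < D], as [2 * D.-1 < D.*2] fails at [D = 0]. *)
have := starD x; rewrite (cardsD1 e) inE xe => /(leq_trans (leq_addr _ 1)) D_gt0.
by have := leq_trans le_deg' le_sum; lia.
Qed.

Definition off_star v e : nat :=
  #|[set f : line_vertex G | (v \notin val f) && (val e :&: val f != set0)]|.

(** Every other edge through [v] is adjacent to [e], and the remaining neighbours avoid [v]. So on
    [star v] the degree is [off_star v] plus a constant, and each fibre of [off_star v] lies in one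
    degree class. *)
Lemma line_degree_star v (e : line_graph G) :
  v \in val e -> degree e = #|star v|.-1 + off_star v e.
Proof.
move=> ve; have -> : #|star v|.-1 = #|star v :\ e|.
  by rewrite [in LHS](cardsD1 e) inE ve.
rewrite /degree -(cardsID (star v : {set line_graph G}) [set f | adj e f]).
congr (_ + _); apply: eq_card => f.
  rewrite !inE /= /line_adj eq_sym; case: (boolP (v \in val f)) => vf;
    rewrite ?andbF //= !andbT.
  by case: eqP => //= _; apply/set0Pn; exists v; rewrite inE ve.
rewrite !inE /= /line_adj; case: (boolP (v \in val f)) => vf //=.
by case: eqP => //= ef; rewrite -ef ve in vf.
Qed.

Lemma sum_off_star v : \sum_(e in star v) off_star v e <= #|edges G|.*2.
Proof.
rewrite (eq_bigr (fun e =>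
  \sum_(f : line_vertex G | (v \notin val f) && (val e :&: val f != set0)) 1)); last first.
  by move=> e _; rewrite sum1_card /off_star cardsE.
rewrite (exchange_big_dep (fun f : line_vertex G => v \notin val f)) /=;
  last by move=> e f _ /andP[].
rewrite -card_line_vertex -muln2 -sum_nat_const.
apply: leq_trans (_ : \sum_(f : line_vertex G | v \notin val f) 2 <= _); last first.
  by rewrite [leqRHS](bigID (fun f : line_vertex G => v \notin val f)) leq_addr.
apply: leq_sum => f vf; rewrite sum1_card -(edge_card f).
(* An edge through [v] that meets [f] at [x] is the pair of [v] and [x], so the two ends of [f]
   allow at most two such edges. *)
rewrite -(card_imset _ val_inj).
apply: leq_trans (leq_imset_card (fun x => [set v; x]) (val f)).
apply/subset_leq_card/subsetP=> _ /imsetP[e He ->].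
case/andP: He; rewrite inE => ve /andP[_ /set0Pn[x]].
rewrite inE => /andP[xe xf]; apply/imsetP; exists x => //.
by apply: edge_pair => //; apply: contraNneq vf => ->.
Qed.

Lemma card_edges_le_cube (r : nat) :
  (forall i, #|degree_class (line_graph G) i| <= r) -> #|edges G| <= 64 * r ^ 3.
Proof.
move=> classr.
have [->|/card_gt0P[e0 e0E]] := posnP #|edges G|; first by [].
have [v0 _] : exists v, v \in e0.
  move: e0E; rewrite inE => /existsP[x /existsP[y /andP[_ /eqP->]]].
  by exists x; rewrite !inE eqxx.
pose v := [arg max_(x > v0) #|star x|]; pose D := #|star v|.
have starD x : #|star x| <= D.
  by rewrite /D /v; case: arg_maxnP => // y _; apply.
have mD : #|edges G| <= r * D.*2.
  rewrite -card_line_vertex -cardsT.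
  apply: leq_trans (@card_lt_fiber _ setT (@degree (line_graph G)) r _ D.*2).
    by apply/subset_leq_card/subsetP=> e _; rewrite !inE line_degree_lt.
  move=> j; apply: leq_trans (classr j); apply/subset_leq_card/subsetP=> e.
  by rewrite !inE.
have gD : (D - r * (16 * r)) * (16 * r) <= #|edges G|.*2.
  apply: leq_trans (sum_off_star v); apply: sum_ge_fiber => j.
  apply: leq_trans (classr (D.-1 + j)); apply/subset_leq_card/subsetP=> e.
  rewrite !inE => /andP[ve /eqP <-]; exact/eqP/line_degree_star.
(* If [m > 64 r ^ 3], then [mD] gives [D > 32 r ^ 2], so [D - 16 r ^ 2] is at least [D / 2]. Now
   [gD] and [mD] give [8 r D <= 2 m <= 4 r D], which is absurd. *)
rewrite leqNgt; apply/negP=> m_gt.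
have r_gt0 : 0 < r by case: (r) mD m_gt; lia.
have D_gt : 32 * (r * r) < D.
  have : r * (64 * (r * r)) < r * D.*2.
    apply: leq_trans mD; apply: leq_trans m_gt; rewrite !expnS expn0 muln1; lia.
  by rewrite ltn_pmul2l //; lia.
have : D * (8 * r) <= (D - r * (16 * r)) * (16 * r).
  have -> : D * (8 * r) = 8 * D * r by lia.
  have -> : (D - r * (16 * r)) * (16 * r) = 16 * (D - r * (16 * r)) * r by lia.
  by rewrite leq_mul2r; apply/orP; right; lia.
move/leq_trans => /(_ _ gD); nia.
Qed.

End LineGraphDegrees.

Section ChromaticBound.

Variables (H : sgraph) (k : nat).

Lemma k_independentP (S : {set H}) :
  reflect (forall v, v \in S -> #|[set w in S | adj v w]| <= k) (k_independent k S).
Proof.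
have degE (v : induced S) : degree v = #|[set w in S | adj (val v) w]|.
  rewrite /degree -(card_imset _ val_inj); apply: eq_card => w.
  apply/imsetP/idP => [[u]|]; first by rewrite !inE => vu ->; rewrite (valP u).
  by rewrite inE => /andP[wS vw]; exists (Sub w wS); rewrite ?inE.
apply: (iffP (bigmax_leqP _ _ _)) => [le_k v vS|le_k v _];
  last by rewrite degE le_k ?(valP v).
by have := le_k (Sub v vS) isT; rewrite degE.
Qed.

Lemma k_independentS (S S' : {set H}) :
  S \subset S' -> k_independent k S' -> k_independent k S.
Proof.
move=> sSS' /k_independentP S'k; apply/k_independentP=> v vS.
apply: leq_trans (S'k v (subsetP sSS' v vS)); apply/subset_leq_card/subsetP=> w.
by rewrite !inE => /andP[/(subsetP sSS')-> ->].
Qed.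

Lemma alpha_reg_ge (S : {set H}) (i : nat) :
  k_independent k S -> S \subset degree_class H i -> #|S| <= alpha_reg k H.
Proof.
(* A vertex of [S] has degree [i], which puts [i] in the range ['I_#|H|.+1]; for empty [S] the index
   may lie outside it. *)
move=> Sk Si; have [->|[v vS]] := set_0Vmem S; first by rewrite cards0.
apply: (@leq_bigmax_cond _ _ (fun S : {set H} => #|S|)).
rewrite /regular_k_independent Sk.
have := subsetP Si v vS; rewrite inE => /eqP iE.
have ltiH : i < #|H|.+1 by rewrite ltnS -iE max_card.
by apply/existsP; exists (Ordinal ltiH).
Qed.

Lemma card_degree_class_le (i : nat) :
  #|degree_class H i| <= chi k H * alpha_reg k H.
Proof.
rewrite /chi; case: ex_minnP => n /existsP[f /forallP fk] _.
rewrite -sum1_card (partition_big f predT) //=.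
rewrite -[leqRHS](_ : \sum_(c : 'I_n) alpha_reg k H = _); last first.
  by rewrite sum_nat_const card_ord.
apply: leq_sum => c _; rewrite sum1_card.
have -> : #|[pred v in degree_class H i | f v == c]| =
          #|[set v in degree_class H i | f v == c]| by rewrite cardsE.
apply: (alpha_reg_ge (i := i)).
  by apply: k_independentS (fk c); apply/subsetP=> v; rewrite !inE => /andP[].
by apply/subsetP=> v; rewrite inE => /andP[].
Qed.

End ChromaticBound.

Local Open Scope ring_scope.

Theorem theorem4p1 (R : realType) (G : sgraph) (k : nat) :
  (alpha_reg k (line_graph G))%:R >=
    (#|edges G|%:R : R) `^ (3%:R)^-1 / (4%:R * (chi k (line_graph G))%:R).
Proof.
set a := alpha_reg k _; set c := chi k _.
(* [c = 0] occurs only for edgeless [G]; the quotient is then [0], since [0^-1 = 0]. *)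
have [->|c_gt0] := posnP c; first by rewrite mulr0 invr0 mulr0 ler0n.
rewrite ler_pdivrMr ?mulr_gt0 ?ltr0n //.
have -> : a%:R * (4 * c%:R) = (4 * (c * a))%:R :> R by rewrite -!natrM mulnCA (mulnC a).
(* The factor [64 = 4 ^ 3] is where the [4] in the denominator comes from. *)
have m_le : (#|edges G| <= (4 * (c * a)) ^ 3)%N.
  by rewrite expnMn; apply/card_edges_le_cube/card_degree_class_le.
have cube_root (n : nat) : n%:R = (n ^ 3)%:R `^ 3%:R^-1 :> R.
  by rewrite natrX -powR_mulrn ?ler0n // -powRrM mulfV ?pnatr_eq0 // powRr1 ?ler0n.
by rewrite [leRHS]cube_root ge0_ler_powR ?invr_ge0 ?nnegrE ?ler0n // ler_nat.
Qed.
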